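(* A cograph is quantum asymmetric if and only if it is asymmetric, in which case it is $K_1$.
   Context: Graphs are finite, simple and undirected, with at least one vertex, considered up to isomorphism; $K_1$ is the one-vertex graph. The class of cographs is the smallest class of graphs containing $K_1$ and stable under finite disjoint unions and complement. A graph is asymmetric if its automorphism group is trivial. For a graph $G$, $\mathcal O(\mathrm{Qu}(G))$ is the universal unital complex $*$-algebra generated by elements $u_{xy}$ ($x,y\in V(G)$) subject to $u_{xy}^*=u_{xy}=u_{xy}^2$, $\sum_{y}u_{xy}=1=\sum_y u_{yx}$ for all $x$, $u_{xy}u_{xz}=0=u_{yx}u_{zx}$ for $y\neq z$, and the entries of $u\,\mathrm{Adj}(G)=\mathrm{Adj}(G)\,u$, where $u=(u_{xy})$ and $\mathrm{Adj}(G)$ is the adjacency matrix. $G$ is quantum asymmetric if its quantum automorphism group $\mathrm{Qu}(G)$ is trivial, i.e. $\mathcal O(\mathrm{Qu}(G))=\mathbb C$. *)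

(* Defs.v *)
From HB Require Import structures.
From mathcomp Require Import all_boot all_order all_algebra all_fingroup.
From mathcomp Require Import generic_quotient.
From mathcomp Require Import boolp reals.
From mathcomp Require Export complex.

Set Implicit Arguments.
Unset Strict Implicit.
Unset Printing Implicit Defensive.

Import Order.TTheory GRing.Theory Num.Theory.
Local Open Scope ring_scope.
Local Open Scope quotient_scope.

(** * Graphs and cographs *)

Record graph := Graph {
  vertex :> finType;
  adj : rel vertex;
  adj_sym : symmetric adj;
  adj_irr : irreflexive adj;
  vertex_gt0 : (0 < #|vertex|)%N
}.

Definition graph_iso (G H : graph) : Prop :=
  exists f : G -> H,
    bijective f /\ forall x y, adj (f x) (f y) = adj x y.

Section GraphOperations.

Lemma K1_sym : symmetric (fun _ _ : unit => false).
Proof. by []. Qed.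
Lemma K1_irr : irreflexive (fun _ _ : unit => false).
Proof. by []. Qed.
Lemma K1_gt0 : (0 < #|{: unit}|)%N.
Proof. by rewrite card_unit. Qed.

Definition K1 : graph := Graph K1_sym K1_irr K1_gt0.

Variable G : graph.

Definition compl_adj : rel G := fun x y => (x != y) && ~~ adj x y.
Lemma compl_sym : symmetric compl_adj.
Proof. by move=> x y; rewrite /compl_adj eq_sym adj_sym. Qed.
Lemma compl_irr : irreflexive compl_adj.
Proof. by move=> x; rewrite /compl_adj eqxx. Qed.

Definition compl_graph : graph := Graph compl_sym compl_irr (vertex_gt0 G).

End GraphOperations.

Section DisjointUnion.
Variables (n : nat) (G : 'I_n.+1 -> graph).

Definition dunion_adj : rel {i : 'I_n.+1 & G i} :=
  fun p q => (tag p == tag q) && adj (tagged p) (tagged_as p q).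

Lemma dunion_sym : symmetric dunion_adj.
Proof.
move=> [i x] [j y]; rewrite /dunion_adj /=.
have [eq_ij|_] := eqVneq i j => //.
by case: j / eq_ij y => y; rewrite !tagged_asE adj_sym.
Qed.

Lemma dunion_irr : irreflexive dunion_adj.
Proof. by move=> [i x]; rewrite /dunion_adj eqxx tagged_asE adj_irr. Qed.

Lemma dunion_gt0 : (0 < #|{: {i : 'I_n.+1 & G i}}|)%N.
Proof.
have /card_gt0P[x _] := vertex_gt0 (G ord0).
by apply/card_gt0P; exists (Tagged (fun i => vertex (G i)) x).
Qed.

(* The families are nonempty because graphs have at least one vertex. *)
Definition dunion : graph := Graph dunion_sym dunion_irr dunion_gt0.

End DisjointUnion.

(* [cograph_iso] is there because a class of graphs means a class of
   isomorphism types. *)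
Inductive cograph : graph -> Prop :=
| cograph_K1 : cograph K1
| cograph_dunion n (G : 'I_n.+1 -> graph) :
    (forall i, cograph (G i)) -> cograph (dunion G)
| cograph_compl G : cograph G -> cograph (compl_graph G)
| cograph_iso G H : graph_iso G H -> cograph G -> cograph H.

Section Automorphisms.
Variable G : graph.

Definition graph_Aut : {set {perm G}} :=
  [set s : {perm G} | [forall x, forall y, adj (s x) (s y) == adj x y]].

Lemma graph_AutP (s : {perm G}) :
  reflect (forall x y, adj (s x) (s y) = adj x y) (s \in graph_Aut).
Proof.
rewrite inE; apply: (iffP forallP) => [h x y|h x].
  by have /forallP/(_ y)/eqP := h x.
by apply/forallP => y; rewrite h.
Qed.

Lemma graph_Aut_group_set : group_set graph_Aut.
Proof.
apply/group_setP; split; first by apply/graph_AutP => x y; rewrite !perm1.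
move=> s t /graph_AutP hs /graph_AutP ht.
by apply/graph_AutP => x y; rewrite !permM ht hs.
Qed.

Canonical graph_Aut_group := Group graph_Aut_group_set.

Definition asymmetric : Prop := (graph_Aut = 1%g).

End Automorphisms.

(** * Unital *-algebras *)

HB.mixin Record hasStar (K : numClosedFieldType) A of GRing.Algebra K A := {
  star : A -> A;
  starK : involutive star;
  starD : forall a b : A, star (a + b) = star a + star b;
  starZ : forall (c : K) (a : A), star (c *: a) = (Num.conj c) *: star a;
  starM : forall a b : A, star (a * b) = star b * star a
}.

#[short(type="starAlgType")]
HB.structure Definition StarAlgebra (K : numClosedFieldType) :=
  {A of GRing.Algebra K A & hasStar K A}.

Definition star_iso (K : numClosedFieldType) (A B : starAlgType K) : Prop :=
  exists f : {lrmorphism A -> B},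
    bijective f /\ forall a, f (star a) = star (f a).

Section RegularStar.
Variable K : numClosedFieldType.

Let cstar (c : K^o) : K^o := Num.conj (c : K).

Fact cstarK : involutive cstar. Proof. exact: conjCK. Qed.
Fact cstarD (a b : K^o) : cstar (a + b) = cstar a + cstar b.
Proof. exact: rmorphD. Qed.
Fact cstarZ (c : K) (a : K^o) : cstar (c *: a) = (Num.conj c) *: cstar a.
Proof. exact: rmorphM. Qed.
Fact cstarM (a b : K^o) : cstar (a * b) = cstar b * cstar a.
Proof. by rewrite /cstar rmorphM mulrC. Qed.

HB.instance Definition _ := hasStar.Build K K^o cstarK cstarD cstarZ cstarM.
End RegularStar.

(** * *-algebras given by generators and relations *)

Inductive sterm (K X : Type) :=
| SGen of X
| SZero
| SOne
| SAdd of sterm K X & sterm K X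
| SScale of K & sterm K X
| SMul of sterm K X & sterm K X
| SStar of sterm K X.

Arguments SGen {K X}.
Arguments SZero {K X}.
Arguments SOne {K X}.

HB.instance Definition _ (K X : Type) := gen_eqMixin (sterm K X).
HB.instance Definition _ (K X : Type) := gen_choiceMixin (sterm K X).

(* The least congruence containing E whose quotient is a unital *-algebra. *)
Inductive scong (K : numClosedFieldType) (X : Type)
    (E : sterm K X -> sterm K X -> Prop) : sterm K X -> sterm K X -> Prop :=
| scong_rel a b : E a b -> scong E a b
| scong_refl a : scong E a a
| scong_sym a b : scong E a b -> scong E b a
| scong_trans a b c : scong E a b -> scong E b c -> scong E a c
| scong_add a a' b b' :
    scong E a a' -> scong E b b' -> scong E (SAdd a b) (SAdd a' b')
| scong_scale k a a' : scong E a a' -> scong E (SScale k a) (SScale k a')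
| scong_mul a a' b b' :
    scong E a a' -> scong E b b' -> scong E (SMul a b) (SMul a' b')
| scong_star a a' : scong E a a' -> scong E (SStar a) (SStar a')
| scong_addA a b c : scong E (SAdd a (SAdd b c)) (SAdd (SAdd a b) c)
| scong_addC a b : scong E (SAdd a b) (SAdd b a)
| scong_add0 a : scong E (SAdd SZero a) a
| scong_addN a : scong E (SAdd (SScale (-1) a) a) SZero
| scong_scaleA k l a : scong E (SScale k (SScale l a)) (SScale (k * l) a)
| scong_scale1 a : scong E (SScale 1 a) a
| scong_scaleDr k a b :
    scong E (SScale k (SAdd a b)) (SAdd (SScale k a) (SScale k b))
| scong_scaleDl k l a :
    scong E (SScale (k + l) a) (SAdd (SScale k a) (SScale l a))
| scong_mulA a b c : scong E (SMul a (SMul b c)) (SMul (SMul a b) c)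
| scong_mul1l a : scong E (SMul SOne a) a
| scong_mul1r a : scong E (SMul a SOne) a
| scong_mulDl a b c :
    scong E (SMul (SAdd a b) c) (SAdd (SMul a c) (SMul b c))
| scong_mulDr a b c :
    scong E (SMul a (SAdd b c)) (SAdd (SMul a b) (SMul a c))
| scong_scaleAl k a b : scong E (SScale k (SMul a b)) (SMul (SScale k a) b)
| scong_scaleAr k a b : scong E (SScale k (SMul a b)) (SMul a (SScale k b))
| scong_starK a : scong E (SStar (SStar a)) a
| scong_starD a b : scong E (SStar (SAdd a b)) (SAdd (SStar a) (SStar b))
| scong_starZ k a :
    scong E (SStar (SScale k a)) (SScale (Num.conj k) (SStar a))
| scong_starM a b : scong E (SStar (SMul a b)) (SMul (SStar b) (SStar a)).

Section Presentation.
Variables (K : numClosedFieldType) (X : Type).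
Variable E : sterm K X -> sterm K X -> Prop.

Definition scongb : rel (sterm K X) := fun a b => `[< scong E a b >].

Fact scongb_refl : reflexive scongb.
Proof. by move=> a; apply/asboolP; apply: scong_refl. Qed.
Fact scongb_sym : symmetric scongb.
Proof. by move=> a b; apply/asboolP/asboolP => h; apply: scong_sym. Qed.
Fact scongb_trans : transitive scongb.
Proof.
by move=> b a c /asboolP h /asboolP h'; apply/asboolP; apply: scong_trans h h'.
Qed.

Canonical scong_equiv := EquivRel scongb scongb_refl scongb_sym scongb_trans.

Definition presented := {eq_quot scong_equiv}.
HB.instance Definition _ := Choice.on presented.

Definition pclass (a : sterm K X) : presented := \pi_({eq_quot scong_equiv}) a.
Definition prepr (p : presented) : sterm K X :=
  repr (p : {eq_quot scong_equiv}).

Lemma pclassE a b : pclass a = pclass b <-> scong E a b.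
Proof.
split; first by move/eqquotP/asboolP.
by move=> h; apply/eqquotP/asboolP.
Qed.

Lemma preprK p : pclass (prepr p) = p.
Proof. exact: reprK. Qed.

Lemma scong_repr a : scong E (prepr (pclass a)) a.
Proof. by apply/pclassE; rewrite preprK. Qed.

Lemma pclassP (P : presented -> Prop) :
  (forall a, P (pclass a)) -> forall p, P p.
Proof. by move=> h p; rewrite -(preprK p). Qed.

Definition padd p q := pclass (SAdd (prepr p) (prepr q)).
Definition pscale k p := pclass (SScale k (prepr p)).
Definition pmul p q := pclass (SMul (prepr p) (prepr q)).
Definition pstar p := pclass (SStar (prepr p)).

Lemma paddE a b : padd (pclass a) (pclass b) = pclass (SAdd a b).
Proof. by apply/pclassE/scong_add; apply: scong_repr. Qed.
Lemma pscaleE k a : pscale k (pclass a) = pclass (SScale k a).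
Proof. by apply/pclassE/scong_scale/scong_repr. Qed.
Lemma pmulE a b : pmul (pclass a) (pclass b) = pclass (SMul a b).
Proof. by apply/pclassE/scong_mul; apply: scong_repr. Qed.
Lemma pstarE a : pstar (pclass a) = pclass (SStar a).
Proof. by apply/pclassE/scong_star/scong_repr. Qed.

Let popsE := (paddE, pscaleE, pmulE, pstarE).

Local Ltac pclass_tac :=
  repeat (elim/pclassP => ?); rewrite ?popsE; apply/pclassE; by constructor.

Fact paddA : associative padd.
Proof. by pclass_tac. Qed.
Fact paddC : commutative padd.
Proof. by pclass_tac. Qed.
Fact padd0 : left_id (pclass SZero) padd.
Proof. by pclass_tac. Qed.
Fact paddN : left_inverse (pclass SZero) (pscale (-1)) padd.
Proof. by pclass_tac. Qed.

HB.instance Definition _ :=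
  GRing.isZmodule.Build presented paddA paddC padd0 paddN.

Fact pscaleA k l p : pscale k (pscale l p) = pscale (k * l) p.
Proof. by move: p; pclass_tac. Qed.
Fact pscale1 : left_id 1 pscale.
Proof. by pclass_tac. Qed.
Fact pscaleDr : right_distributive pscale +%R.
Proof. by move=> k; rewrite /GRing.add /=; pclass_tac. Qed.
Fact pscaleDl p : {morph pscale^~ p : k l / k + l}.
Proof. by move=> k l; move: p; rewrite /GRing.add /=; pclass_tac. Qed.

HB.instance Definition _ := GRing.Zmodule_isLmodule.Build K presented
  pscaleA pscale1 pscaleDr pscaleDl.

Fact pmulA : associative pmul.
Proof. by pclass_tac. Qed.
Fact pmul1l : left_id (pclass SOne) pmul.
Proof. by pclass_tac. Qed.
Fact pmul1r : right_id (pclass SOne) pmul.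
Proof. by pclass_tac. Qed.
Fact pmulDl : left_distributive pmul +%R.
Proof. by rewrite /GRing.add /=; pclass_tac. Qed.
Fact pmulDr : right_distributive pmul +%R.
Proof. by rewrite /GRing.add /=; pclass_tac. Qed.

HB.instance Definition _ := GRing.Zmodule_isPzRing.Build presented
  pmulA pmul1l pmul1r pmulDl pmulDr.

End Presentation.

(* Evaluation of terms in a *-algebra. *)
Fixpoint seval (K : numClosedFieldType) (A : starAlgType K) (X : Type)
    (v : X -> A) (t : sterm K X) : A :=
  match t with
  | SGen x => v x
  | SZero => 0
  | SOne => 1
  | SAdd a b => seval v a + seval v b
  | SScale k a => k *: seval v a
  | SMul a b => seval v a * seval v b
  | SStar a => star (seval v a)
  end.

Lemma seval_scong (K : numClosedFieldType) (A : starAlgType K) (X : Type)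
    (E : sterm K X -> sterm K X -> Prop) (v : X -> A) :
  (forall a b, E a b -> seval v a = seval v b) ->
  forall a b, scong E a b -> seval v a = seval v b.
Proof.
move=> hE a b; elim=> //=; clear a b.
- by move=> a b c _ -> _ ->.
- by move=> a a' b b' _ -> _ ->.
- by move=> k a a' _ ->.
- by move=> a a' b b' _ -> _ ->.
- by move=> a a' _ ->.
- by move=> a b c; rewrite addrA.
- by move=> a b; rewrite addrC.
- by move=> a; rewrite add0r.
- by move=> a; rewrite scaleN1r addNr.
- by move=> k l a; rewrite scalerA.
- by move=> a; rewrite scale1r.
- by move=> k a b; rewrite scalerDr.
- by move=> k l a; rewrite scalerDl.
- by move=> a b c; rewrite mulrA.
- by move=> a; rewrite mul1r.
- by move=> a; rewrite mulr1.
- by move=> a b c; rewrite mulrDl.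
- by move=> a b c; rewrite mulrDr.
- by move=> k a b; rewrite scalerAl.
- by move=> k a b; rewrite scalerAr.
- by move=> a; rewrite starK.
- by move=> a b; rewrite starD.
- by move=> k a; rewrite starZ.
- by move=> a b; rewrite starM.
Qed.

(** * The quantum automorphism group of a graph *)

Section QuantumAutomorphismGroup.
Variables (K : numClosedFieldType) (G : graph).

Definition adj_coef (x y : G) : K := (adj x y)%:R.

Local Notation term := (sterm K (G * G)).
Local Notation u x y := (@SGen K (G * G)%type (x, y)).
Local Notation "\ssum_ x t" := (\big[@SAdd K (G * G)%type/SZero]_(x : G) t)
  (at level 41, x at level 0, t at level 41).

Inductive qu_rel : term -> term -> Prop :=
| qu_selfadj x y : qu_rel (SStar (u x y)) (u x y)
| qu_idem x y : qu_rel (u x y) (SMul (u x y) (u x y))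
| qu_row x : qu_rel (\ssum_y u x y) SOne
| qu_col x : qu_rel (\ssum_y u y x) SOne
| qu_row_orth x y z : y != z -> qu_rel (SMul (u x y) (u x z)) SZero
| qu_col_orth x y z : y != z -> qu_rel (SMul (u y x) (u z x)) SZero
(* entry (x, y) of u Adj(G) = Adj(G) u *)
| qu_adj x y :
    qu_rel (\ssum_z SScale (adj_coef z y) (u x z))
           (\ssum_z SScale (adj_coef x z) (u z y)).

Definition O_Qu : Type := presented qu_rel.

HB.instance Definition _ := GRing.PzRing.on O_Qu.
HB.instance Definition _ := GRing.Lmodule.on O_Qu.

(* The defining relations, for a matrix of elements of a *-algebra. *)
Definition qu_matrix (A : starAlgType K) (v : G -> G -> A) : Prop :=
  [/\ forall x y, star (v x y) = v x y /\ v x y = v x y * v x y,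
      forall x, \sum_y v x y = 1 /\ \sum_y v y x = 1,
      forall x y z, y != z -> v x y * v x z = 0 /\ v y x * v z x = 0
    & forall x y, \sum_z adj_coef z y *: v x z = \sum_z adj_coef x z *: v z y].

Lemma seval_sum (A : starAlgType K) (v : G * G -> A) (t : G -> term) :
  seval v (\ssum_x t x) = \sum_x seval v (t x).
Proof. exact: (big_morph (seval v)). Qed.

Lemma seval_qu (A : starAlgType K) (v : G -> G -> A) :
  qu_matrix v ->
  forall a b, scong qu_rel a b ->
  seval (fun p => v p.1 p.2) a = seval (fun p => v p.1 p.2) b.
Proof.
case=> h1 h2 h3 h4; apply: seval_scong => a b.
case=> /= [x y|x y|x|x|x y z ne|x y z ne|x y]; rewrite ?seval_sum /=.
- by case: (h1 x y).
- by case: (h1 x y).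
- by case: (h2 x).
- by case: (h2 x).
- by case: (h3 x y z ne).
- by case: (h3 x y z ne).
- exact: h4.
Qed.

(* The counit, needed because algebras are nonzero in the library. *)
Definition counit_mx (x y : G) : K^o := (x == y)%:R.

Lemma counit_mxP : qu_matrix counit_mx.
Proof.
have sum1 (f : G -> K^o) x : (forall y, y != x -> f y = 0) -> \sum_y f y = f x.
  by move=> h; rewrite (bigD1 x) //= big1 ?addr0.
rewrite /counit_mx; split.
- move=> x y; split; last by case: eqP => _; rewrite ?mulr1 ?mulr0.
  exact: (rmorph_nat (@Num.conj K)).
- move=> x; split.
    by rewrite (sum1 _ x) ?eqxx // => y; rewrite eq_sym => /negPf ->.
  by rewrite (sum1 _ x) ?eqxx // => y /negPf ->.
- move=> x y z ne; split.
    by case: (eqVneq x y) => [->|_]; rewrite ?mul0r // (negPf ne) mulr0.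
  by case: (eqVneq y x) => [<-|_]; rewrite ?mul0r // eq_sym (negPf ne) mulr0.
- move=> x y; rewrite (sum1 _ x); last first.
    by move=> z; rewrite eq_sym => /negPf ->; rewrite scaler0.
  rewrite (sum1 _ y); last by move=> z /negPf ->; rewrite scaler0.
  by rewrite !eqxx.
Qed.

Fact O_Qu_nonzero : (1 : O_Qu) != 0.
Proof.
apply/eqP => /pclassE /(seval_qu counit_mxP) /= /eqP.
by rewrite oner_eq0.
Qed.

HB.instance Definition _ :=
  GRing.PzSemiRing_isNonZero.Build O_Qu O_Qu_nonzero.

Local Ltac class_tac :=
  repeat (elim/pclassP => ?);
  rewrite ?/GRing.scale ?/GRing.mul ?/GRing.add /=
    ?(paddE, pscaleE, pmulE, pstarE);
  apply/pclassE; by constructor.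

Fact O_Qu_scaleAl k (a b : O_Qu) : k *: (a * b) = (k *: a) * b.
Proof. by move: a b; class_tac. Qed.
HB.instance Definition _ := GRing.Lmodule_isLalgebra.Build K O_Qu O_Qu_scaleAl.

Fact O_Qu_scaleAr k (a b : O_Qu) : k *: (a * b) = a * (k *: b).
Proof. by move: a b; class_tac. Qed.
HB.instance Definition _ := GRing.Lalgebra_isAlgebra.Build K O_Qu O_Qu_scaleAr.

Definition qstar : O_Qu -> O_Qu := @pstar K (G * G) qu_rel.

Fact qstarK : involutive qstar.
Proof. by rewrite /qstar; class_tac. Qed.
Fact qstarD (a b : O_Qu) : qstar (a + b) = qstar a + qstar b.
Proof. by move: a b; rewrite /qstar; class_tac. Qed.
Fact qstarZ k (a : O_Qu) : qstar (k *: a) = (Num.conj k) *: qstar a.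
Proof. by move: a; rewrite /qstar; class_tac. Qed.
Fact qstarM (a b : O_Qu) : qstar (a * b) = qstar b * qstar a.
Proof. by move: a b; rewrite /qstar; class_tac. Qed.
HB.instance Definition _ := hasStar.Build K O_Qu qstarK qstarD qstarZ qstarM.

Definition O_Qu_class (a : term) : O_Qu := pclass qu_rel a.

Lemma O_Qu_addE a b : O_Qu_class a + O_Qu_class b = O_Qu_class (SAdd a b).
Proof. exact: paddE. Qed.
Lemma O_Qu_scaleE k a : k *: O_Qu_class a = O_Qu_class (SScale k a).
Proof. exact: pscaleE. Qed.
Lemma O_Qu_mulE a b : O_Qu_class a * O_Qu_class b = O_Qu_class (SMul a b).
Proof. exact: pmulE. Qed.
Lemma O_Qu_starE a : star (O_Qu_class a) = O_Qu_class (SStar a).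
Proof. exact: pstarE. Qed.
Lemma O_Qu_sumE (t : G -> term) :
  \sum_x O_Qu_class (t x) = O_Qu_class (\ssum_x t x).
Proof.
by apply/esym/(big_morph O_Qu_class) => // a b; rewrite O_Qu_addE.
Qed.

Lemma O_Qu_classP (P : O_Qu -> Prop) :
  (forall a, P (O_Qu_class a)) -> forall p, P p.
Proof. exact: pclassP. Qed.

Definition O_Qu_gen (x y : G) : O_Qu := O_Qu_class (u x y).

Lemma O_Qu_genP : qu_matrix O_Qu_gen.
Proof.
have rel a b : qu_rel a b -> O_Qu_class a = O_Qu_class b.
  by move=> h; apply/pclassE/scong_rel.
split.
- move=> x y; rewrite O_Qu_starE O_Qu_mulE.
  by split; apply/rel; constructor.
- by move=> x; rewrite !O_Qu_sumE; split; apply/rel; constructor.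
- move=> x y z ne; rewrite !O_Qu_mulE.
  by split; apply/rel; constructor.
- move=> x y.
  under eq_bigr do rewrite O_Qu_scaleE.
  under [RHS]eq_bigr do rewrite O_Qu_scaleE.
  by rewrite !O_Qu_sumE; apply/rel/qu_adj.
Qed.

Section Universal.
Variables (A : starAlgType K) (v : G -> G -> A).
Hypothesis hv : qu_matrix v.

Definition O_Qu_lift (p : O_Qu) : A := seval (fun p => v p.1 p.2) (prepr p).

Lemma O_Qu_liftE a :
  O_Qu_lift (O_Qu_class a) = seval (fun p => v p.1 p.2) a.
Proof. exact/(seval_qu hv)/scong_repr. Qed.

Fact O_Qu_lift_linear : linear O_Qu_lift.
Proof.
move=> k; elim/O_Qu_classP => a; elim/O_Qu_classP => b.
by rewrite O_Qu_scaleE O_Qu_addE !O_Qu_liftE.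
Qed.
HB.instance Definition _ :=
  GRing.isLinear.Build K O_Qu A _ O_Qu_lift O_Qu_lift_linear.

Fact O_Qu_lift_monoid : monoid_morphism O_Qu_lift.
Proof.
split; first exact: O_Qu_liftE.
elim/O_Qu_classP => a; elim/O_Qu_classP => b.
by rewrite O_Qu_mulE !O_Qu_liftE.
Qed.
HB.instance Definition _ :=
  GRing.isMonoidMorphism.Build O_Qu A O_Qu_lift O_Qu_lift_monoid.

Lemma O_Qu_universal : exists f : {lrmorphism O_Qu -> A},
  [/\ forall x y, f (O_Qu_gen x y) = v x y,
      forall a, f (star a) = star (f a)
    & forall g : {lrmorphism O_Qu -> A},
        (forall x y, g (O_Qu_gen x y) = v x y) ->
        (forall a, g (star a) = star (g a)) -> g =1 f].
Proof.
exists O_Qu_lift; split.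
- by move=> x y; exact: O_Qu_liftE.
- by elim/O_Qu_classP => a; rewrite O_Qu_starE /= !O_Qu_liftE.
move=> g hg hs; elim/O_Qu_classP => a; rewrite /= O_Qu_liftE.
elim: a => [[x y]|||a ha b hb|k a ha|a ha b hb|a ha] /=.
- exact: hg.
- exact: (raddf0 g).
- exact: (rmorph1 g).
- by rewrite -O_Qu_addE raddfD /= ha hb.
- by rewrite -O_Qu_scaleE linearZ /= ha.
- by rewrite -O_Qu_mulE rmorphM /= ha hb.
- by rewrite -O_Qu_starE hs ha.
Qed.

End Universal.

(* O(Qu(G)) is the algebra of scalars, up to *-isomorphism. *)
Definition quantum_asymmetric : Prop := star_iso O_Qu K^o.

End QuantumAutomorphismGroup.

(* Main.v *)
(** A cograph with more than one vertex has a pair of twins, and exchanging two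
    twins is a nontrivial automorphism. On the other hand every automorphism is
    a character of O(Qu(G)), and an algebra reduced to the scalars has only one
    character. *)
Require Import Defs.
From mathcomp Require Import all_boot all_order all_algebra.
From mathcomp Require Import all_fingroup.
From mathcomp Require Import reals complex.

Local Open Scope complex_scope.

Set Implicit Arguments.
Unset Strict Implicit.
Unset Printing Implicit Defensive.

Import GRing.Theory.
Local Open Scope ring_scope.

(** The condition says nothing about the pair itself, so adjacent and nonadjacent twins are both
    covered and the notion is stable under complement. *)
Definition twins (G : graph) (x y : G) : Prop :=
  x != y /\ forall z, z != x -> z != y -> adj x z = adj y z.

(** Pairs meeting {x, y} in one vertex are handled by the twin condition; pairs inside {x, y} by
    symmetry and irreflexivity of [adj]. *)
Lemma twins_tperm_Aut (G : graph) (x y : G) :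
  twins x y -> tperm x y \in graph_Aut G.
Proof.
move=> [ne tw]; apply/graph_AutP => a b.
have tw' z : z != x -> z != y -> adj z x = adj z y.
  by move=> zx zy; rewrite !(adj_sym z) tw.
case: (tpermP x y a) => [->|->|/eqP ax /eqP ay];
  case: (tpermP x y b) => [->|->|/eqP bx /eqP b_y];
  rewrite ?adj_irr ?(tw _ bx b_y) ?(tw' _ ax ay) //.
all: exact: adj_sym.
Qed.

Lemma twins_not_asymmetric (G : graph) (x y : G) : twins x y -> ~ asymmetric G.
Proof.
move=> tw as_G; have := twins_tperm_Aut tw.
rewrite as_G => /set1P /permP /(_ x); rewrite tpermL perm1 => /eqP.
by rewrite eq_sym (negPf tw.1).
Qed.

Lemma twins_compl (G : graph) (x y : G) :
  twins x y -> @twins (compl_graph G) x y.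
Proof.
move=> [ne tw]; split=> // z zx zy.
by rewrite /= /compl_adj tw // !(eq_sym _ z) zx zy.
Qed.

Lemma twins_dunion n (G : 'I_n.+1 -> graph) i (x y : G i) :
  twins x y ->
  @twins (dunion G) (Tagged (fun i => vertex (G i)) x)
                    (Tagged (fun i => vertex (G i)) y).
Proof.
move=> [ne tw]; split; first by rewrite eq_Tagged.
case=> j z; rewrite /= /dunion_adj /=.
have [eq_ij|//] := eqVneq i j; case: j / eq_ij z => z.
by rewrite !eq_Tagged !tagged_asE /=; apply: tw.
Qed.

(** Induction on the construction of the cograph. In a disjoint union, twins of a component remain
    twins; if no component has any, all components are single vertices. *)
Lemma cograph_twins (G : graph) :
  cograph G -> #|G| = 1%N \/ exists x y : G, twins x y.
Proof.
elim=> {G} [|n G _ IH|G _ IH|G H [f [f_bij f_adj]] _ IH].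
- by left; exact: card_unit.
- have [[i [x [y tw]]]|no_tw] :=
    boolp.EM (exists i, exists x y : G i, twins x y).
    by right; do 2!eexists; apply: twins_dunion tw.
  have card1 i : #|G i| = 1%N by case: (IH i) => // h; case: no_tw; exists i.
  case: n G {IH no_tw} card1 => [|n] G card1.
    left; rewrite card_tagged sumnE big_map big_enum /= big_ord_recl big_ord0.
    by rewrite addn0 card1.
  right.
  (* Every component is a single vertex, so the union has no edge. *)
  have no_adj (p q : dunion G) : adj p q = false.
    case: p q => [i x] [j y]; rewrite /= /dunion_adj /=.
    have [eq_ij|//] := eqVneq i j; case: j / eq_ij y => y.
    have /mem_card1[z zP] : #|G i| = 1%N by [].
    have xz : x = z by apply/eqP; rewrite -[_ == _]zP.
    have yz : y = z by apply/eqP; rewrite -[_ == _]zP.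
    by rewrite tagged_asE xz yz adj_irr.
  (* There are now at least two components, so [ord0] and [ord_max] differ; in an edgeless graph any
     two distinct vertices are twins. *)
  have /card_gt0P[x _] := vertex_gt0 (G ord0).
  have /card_gt0P[y _] := vertex_gt0 (G ord_max).
  exists (Tagged (fun i => vertex (G i)) x), (Tagged (fun i => vertex (G i)) y).
  by split=> // z _ _; rewrite !no_adj.
- case: IH => [|[x [y tw]]]; first by left.
  by right; exists x, y; apply: twins_compl.
- case: IH => [card1|[x [y [ne tw]]]].
    by left; rewrite -(bij_eq_card f_bij).
  right; exists (f x), (f y); have [g fK gK] := f_bij.
  split=> [|z]; first by rewrite (inj_eq (bij_inj f_bij)).
  rewrite -(gK z) !(inj_eq (bij_inj f_bij)) !f_adj.
  exact: tw.
Qed.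

Lemma cograph_asymmetric_card (G : graph) :
  cograph G -> asymmetric G -> #|G| = 1%N.
Proof.
by move=> /cograph_twins[//|[x [y tw]]] /(twins_not_asymmetric tw).
Qed.

Lemma card1_graph_iso_K1 (G : graph) : #|G| = 1%N -> graph_iso G K1.
Proof.
move=> /mem_card1[x0 x0P].
have all_x0 (x : G) : x = x0 by apply/eqP; rewrite -[_ == _]x0P.
exists (fun=> tt); split.
  by exists (fun=> x0) => [x|[]].
by move=> x y; rewrite (all_x0 x) (all_x0 y) !adj_irr.
Qed.

Section QuantumSymmetry.
Variables (K : numClosedFieldType) (G : graph).

(** The permutation matrix of [s]: the values on the generators of the character given by evaluation
    at [s]. The identity permutation gives [counit_mx]. *)
Definition perm_magic (s : {perm G}) (x y : G) : K^o := (s x == y)%:R.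

Lemma sum_delta (f : G -> K^o) x :
  (forall y, y != x -> f y = 0) -> \sum_y f y = f x.
Proof. by move=> h; rewrite (bigD1 x) //= big1 ?addr0. Qed.

Lemma perm_magicP (s : {perm G}) : s \in graph_Aut G -> qu_matrix (perm_magic s).
Proof.
have sE x y : (s x == y) = (x == (s^-1)%g y).
  by rewrite -{1}[y](permKV s) (inj_eq perm_inj).
move=> /graph_AutP s_adj; rewrite /perm_magic; split.
- move=> x y; split; last by case: eqP => _; rewrite ?mulr1 ?mulr0.
  exact: (rmorph_nat (@Num.conj K)).
- move=> x; split.
    rewrite (sum_delta (x := s x)) ?eqxx // => y.
    by rewrite eq_sym => /negPf ->.
  rewrite (sum_delta (x := (s^-1)%g x)) ?permKV ?eqxx // => y.
  by rewrite sE => /negPf ->.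
- move=> x y z ne; split.
    by case: (eqVneq (s x) y) => [->|_]; rewrite ?mul0r // (negPf ne) mulr0.
  rewrite !sE.
  by case: (eqVneq y) => [<-|_]; rewrite ?mul0r // eq_sym (negPf ne) mulr0.
(* The two sums collapse to [adj (s x) y] and [adj x (s^-1 y)], which agree because [s] preserves
   adjacency. *)
- move=> x y; rewrite (sum_delta (x := s x)); last first.
    by move=> z; rewrite eq_sym => /negPf ->; rewrite scaler0.
  rewrite (sum_delta (x := (s^-1)%g y)); last first.
    by move=> z; rewrite sE => /negPf ->; rewrite scaler0.
  by rewrite permKV !eqxx /adj_coef -(s_adj x) permKV.
Qed.

(** The elements [a] and [f a *: 1] have the same image under the injective map [f]. *)
Lemma star_iso_scalar (A : starAlgType K) :
  star_iso A K^o -> forall a : A, exists c : K, a = c *: 1.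
Proof.
case=> f [f_bij _] a; exists (f a); apply: (bij_inj f_bij).
by rewrite linearZ /= rmorph1; rewrite /GRing.scale /= mulr1.
Qed.

Lemma quantum_asymmetric_asymmetric : quantum_asymmetric K G -> asymmetric G.
Proof.
move=> /star_iso_scalar scal; apply/eqP; rewrite eqEsubset sub1G andbT.
apply/subsetP => s sG; apply/set1P/permP => x; rewrite perm1.
have [f [f_gen _ _]] := O_Qu_universal (perm_magicP sG).
have [g [g_gen _ _]] := O_Qu_universal (counit_mxP K G).
have [c uE] := scal (O_Qu_gen K x x).
(* Unital linear maps to the scalars agree on multiples of 1, hence on the generator at (x, x),
   where the characters of [s] and of the identity take the values [s x = x] and 1. *)
have : perm_magic s x x = counit_mx K x x.
  by rewrite -f_gen -g_gen uE !linearZ /= !rmorph1.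
rewrite /perm_magic /counit_mx eqxx; case: eqP => // _ /eqP.
by rewrite eq_sym oner_eq0.
Qed.

Lemma star1 (A : starAlgType K) : star (1 : A) = 1.
Proof. by rewrite -[LHS]mul1r -{1}[1]starK -starM mul1r starK. Qed.

Lemma card1_O_Qu_scalar :
  #|G| = 1%N -> forall a : O_Qu K G, exists c : K, a = c *: 1.
Proof.
move=> /mem_card1[x0 x0P].
have all_x0 (x : G) : x = x0 by apply/eqP; rewrite -[_ == _]x0P.
have [_ rows _ _] := O_Qu_genP K G.
elim/O_Qu_classP; elim=> [[x y]|||a [c ac] b [d bd]|k a [c ac]
                         |a [c ac] b [d bd]|a [c ac]].
(* The row sum has a single term, so the only generator equals 1. *)
- exists 1; rewrite scale1r -(rows x).1 (bigD1 y) //= big1 ?addr0 // => z.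
  by rewrite (all_x0 z) (all_x0 y) eqxx.
- by exists 0; rewrite scale0r.
- by exists 1; rewrite scale1r.
- by exists (c + d); rewrite -O_Qu_addE ac bd scalerDl.
- by exists (k * c); rewrite -O_Qu_scaleE ac scalerA.
- by exists (c * d); rewrite -O_Qu_mulE ac bd -scalerAl mul1r scalerA.
- by exists (Num.conj c); rewrite -O_Qu_starE ac starZ star1.
Qed.

(** The counit is inverse to the embedding of the scalars as multiples of 1, which is onto here. *)
Lemma card1_quantum_asymmetric : #|G| = 1%N -> quantum_asymmetric K G.
Proof.
move=> /card1_O_Qu_scalar scal.
have [f [_ f_star _]] := O_Qu_universal (counit_mxP K G).
have fZ (c : K) : f (c *: 1) = c.
  by rewrite linearZ /= rmorph1; rewrite /GRing.scale /= mulr1.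
exists f; split=> //; exists (fun c : K => c *: 1) => [a|]; last exact: fZ.
by have [c ->] := scal a; rewrite fZ.
Qed.

End QuantumSymmetry.

Theorem corollary4p4 (R : realType) (G : graph) (hG : cograph G) :
  (quantum_asymmetric R[i] G <-> asymmetric G) /\
  (asymmetric G -> graph_iso G K1).
Proof.
split; last by move=> /(cograph_asymmetric_card hG)/card1_graph_iso_K1.
split; first exact: quantum_asymmetric_asymmetric.
by move=> /(cograph_asymmetric_card hG)/card1_quantum_asymmetric.
Qed.
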